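(* In the setting and with the notation of the context, for all $t\ge0$ and $Y\in\mathfrak g$ we have $$S^*(t)\pi(Y)u^*=\pi(e^{tL}Y)u^*=\pi(e^{-tX}Ye^{tX})u^*,$$ where $L:\mathfrak g\to\mathfrak g$ is the linear map $LY=[Y,X]$ and $e^{tL}$ is defined by the power series.
   Context: $\mathcal X$ is a real Banach space, $\mathcal L(\mathcal X)$ the bounded linear operators on it. $A$ is a closed (possibly unbounded) linear operator on $\mathcal X$ with domain $\mathcal D(A)$, and $F:\mathcal X\to\mathcal X$ is a map. The equation is $\mathrm du=Au\,\mathrm dt+F(u)\,\mathrm dt$. Standing assumptions: (1) Symmetry. $\mathbb G$ is a matrix Lie group with Lie algebra $\mathfrak g$ (bracket $[\cdot,\cdot]$, exponential map $\exp(Y)=e^Y$, a fixed norm $\|\cdot\|_{\mathfrak g}$), and $\Pi:\mathbb G\to\mathcal L(\mathcal X)$ is a group homomorphism such that: for $g\in\mathbb G$ and $\phi\in\mathcal D(A)$ we have $\Pi(g)\phi\in\mathcal D(A)$, $A\phi=\Pi(g)A\Pi(g^{-1})\phi$ and $F(\phi)=\Pi(g)F(\Pi(g^{-1})\phi)$; for each $\phi\in\mathcal X$ the map $g\mapsto\Pi(g)\phi$ is continuous; $\sup_{g}\|\Pi(g)\|_{\mathcal L(\mathcal X)}<\infty$. For $Y\in\mathfrak g$, $\pi(Y)$ is the unbounded operator $\pi(Y)\phi=\lim_{t\to0}t^{-1}(\Pi(e^{tY})\phi-\phi)$ (limit in $\mathcal X$), whose domain $\mathcal D(\pi(Y))$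 consists of all $\phi\in\mathcal X$ for which the limit exists. (2) Symmetry solution. There are $X\in\mathfrak g$ and $u^*\in\mathcal D(A)\cap\mathcal D(\pi(X))$ such that $\hat u(t)=\Pi(e^{tX})u^*$, $t\ge0$, is a strong solution of the equation. Moreover $u^*\in\mathcal D(\pi(Y))$ for all $Y\in\mathfrak g$ and there is a constant $C$ with $\|\Pi(e^Y)u^*-u^*-\pi(Y)u^*\|_{\mathcal X}\le C\|Y\|_{\mathfrak g}^2$ for all $Y\in\mathfrak g$. (3) Linearization. $F$ is Fréchet differentiable at $u^*$, and the operator $\mathcal L^*:\phi\mapsto A\phi-\pi(X)\phi+F'(u^* )\phi$ (natural domain $\mathcal D(A)\cap\mathcal D(\pi(X))$; $^*$ does not denote an adjoint) generates a bounded $C_0$-semigroup $(S^*(t))_{t\ge0}$ on $\mathcal X$. *)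

(* Defs.v *)
From HB Require Import structures.
From mathcomp Require Import all_boot all_order all_algebra.
From mathcomp Require Export complex.
From mathcomp Require Import all_classical all_reals all_analysis.

Set Implicit Arguments.
Unset Strict Implicit.
Unset Printing Implicit Defensive.

Import Order.TTheory GRing.Theory Num.Theory.
Import numFieldNormedType.Exports.

Local Open Scope classical_set_scope.
Local Open Scope ring_scope.
Local Open Scope complex_scope.

(* The usual topology of the complex numbers, given by the modulus. *)
HB.instance Definition _ (R : realType) :=
  NormedModule.copy R[i] (R[i] : numFieldType)^o.

(* Matrix Lie groups.  Matrices have complex entries; a closed subgroup of
   GL_n(R) is in particular a closed subgroup of GL_n(C), with the same Lie
   algebra, so real matrix Lie groups are covered. *)
Section MatrixLieGroup.
Variables (R : realType) (n : nat).
Implicit Types (G : set 'M[R[i]]_n) (X Y : 'M[R[i]]_n).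

Definition matrix_lie_group G : Prop :=
  [/\ G `<=` [set g | g \in unitmx],
      G 1%:M,
      forall g h, G g -> G h -> G (g *m h),
      forall g, G g -> G (invmx g) &
      closure G `&` [set g | g \in unitmx] `<=` G].

Definition expmx Y : 'M[R[i]]_n :=
  lim (series (fun k => k`!%:R^-1 *: Y ^+ k) @ \oo).

(* A subset of 'M[R[i]]_n that is a real, in general not a complex, linear
   subspace; hence the scalars t%:C with t : R. *)
Definition lie_algebra G : set 'M[R[i]]_n :=
  [set Y | forall t : R, G (expmx (t%:C *: Y))].

Definition lie_bracket X Y : 'M[R[i]]_n := X *m Y - Y *m X.

(* The power series e^{tL} of a linear map L, evaluated at Y. *)
Definition exp_lin (t : R) (L : 'M[R[i]]_n -> 'M[R[i]]_n) Y : 'M[R[i]]_n :=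
  lim (series (fun k => (t ^+ k / k`!%:R)%:C *: iter k L Y) @ \oo).

Definition norm_on (g : set 'M[R[i]]_n) (N : 'M[R[i]]_n -> R) : Prop :=
  [/\ forall Y, g Y -> 0 <= N Y,
      forall Y, g Y -> N Y = 0 -> Y = 0,
      forall (t : R) Y, g Y -> N (t%:C *: Y) = `|t| * N Y &
      forall Y Z, g Y -> g Z -> N (Y + Z) <= N Y + N Z].

End MatrixLieGroup.

(* Unbounded operators.  The values of [op] outside [dom] are irrelevant. *)
Record unbounded_op (V : Type) := UnboundedOp { dom : set V ; op :> V -> V }.

Section Operators.
Variables (R : realType) (V : completeNormedModType R).
Implicit Types (A B : unbounded_op V) (F : V -> V) (u : R -> V).

Definition closed_linear_op A : Prop :=
  [/\ dom A 0,
      forall (a : R) (x y : V), dom A x -> dom A y ->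
        dom A (a *: x + y) /\ A (a *: x + y) = a *: A x + A y &
      closed [set p : V * V | dom A p.1 /\ p.2 = A p.1]].

Definition eq_op_dom A B : Prop :=
  dom A = dom B /\ (forall x, dom A x -> A x = B x).

(* The intervals [a i, b i] are non-overlapping and listed from left to right. *)
Definition abs_continuous_on (s t : R) u : Prop :=
  forall e : R, 0 < e -> exists2 d : R, 0 < d &
    forall (m : nat) (a b : nat -> R),
      (forall i, (i < m)%N -> [/\ s <= a i, a i <= b i & b i <= t]) ->
      (forall i, (i.+1 < m)%N -> b i <= a i.+1) ->
      \sum_(i < m) (b i - a i) < d ->
      \sum_(i < m) `|u (b i) - u (a i)| < e.

(* Strong solutions of du = A u dt + F(u) dt on [0, +oo): locally absolutely
   continuous, the equation holding almost everywhere.  This is the same as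
   u(t) = u(0) + \int_0^t (A u + F(u)) ds with a locally Bochner integrable
   integrand. *)
Definition strong_solution A F u : Prop :=
  (forall T : R, 0 <= T -> abs_continuous_on 0 T u) /\
  {ae (@lebesgue_measure R), forall t : R, 0 < t ->
     dom A (u t) /\ is_derive t 1 u (A (u t) + F (u t))}.

Definition C0_semigroup (S : R -> {linear V -> V}) : Prop :=
  [/\ forall t : R, 0 <= t -> continuous (S t),
      forall x, S 0 x = x,
      forall s t : R, 0 <= s -> 0 <= t -> forall x, S (s + t) x = S s (S t x) &
      forall x, S t x @[t --> 0^'+] --> x].

Definition uniformly_bounded (I : Type) (D : set I) (T : I -> {linear V -> V}) :=
  exists M : R, forall i, D i -> forall x, `|T i x| <= M * `|x|.

Definition generator (S : R -> {linear V -> V}) : unbounded_op V :=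
  UnboundedOp [set x | cvg (h^-1 *: (S h x - x) @[h --> 0^'+])]
              (fun x => lim (h^-1 *: (S h x - x) @[h --> 0^'+])).

Definition generates A (S : R -> {linear V -> V}) : Prop :=
  eq_op_dom (generator S) A.

End Operators.

Section Representation.
Variables (R : realType) (V : completeNormedModType R) (n : nat).
Variables (G : set 'M[R[i]]_n) (Pi : 'M[R[i]]_n -> {linear V -> V}).

(* Group homomorphisms from G to the bounded operators; the values of Pi
   outside G are irrelevant. *)
Definition is_representation : Prop :=
  [/\ forall g, G g -> continuous (Pi g),
      forall x, Pi 1%:M x = x &
      forall g h, G g -> G h -> forall x, Pi (g *m h) x = Pi g (Pi h x)].

Definition strongly_continuous : Prop :=
  forall x, {within G, continuous (fun g => Pi g x)}.

Definition equivariant (A : unbounded_op V) (F : V -> V) : Prop :=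
  forall g x, G g -> dom A x ->
    [/\ dom A (Pi g x), A x = Pi g (A (Pi (invmx g) x)) &
        F x = Pi g (F (Pi (invmx g) x))].

Definition pi_op (Y : 'M[R[i]]_n) : unbounded_op V :=
  UnboundedOp
    [set x | cvg (t^-1 *: (Pi (expmx (t%:C *: Y)) x - x) @[t --> (0 : R)^'])]
    (fun x => lim (t^-1 *: (Pi (expmx (t%:C *: Y)) x - x) @[t --> (0 : R)^'])).

Definition linearized_op (A : unbounded_op V) (F : V -> V) (X : 'M[R[i]]_n)
    (u : V) : unbounded_op V :=
  UnboundedOp (dom A `&` dom (pi_op X))
              (fun x => A x - pi_op X x + 'd F u x).

End Representation.

(* Main.v *)
Require Import Defs.
From HB Require Import structures.
From mathcomp Require Import all_boot all_order all_algebra.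
From mathcomp Require Import complex ring lra.
From mathcomp Require Import all_classical all_reals all_analysis.

Set Implicit Arguments.
Unset Strict Implicit.
Unset Printing Implicit Defensive.

Import Order.TTheory GRing.Theory Num.Theory.
Import numFieldNormedType.Exports.

Local Open Scope classical_set_scope.
Local Open Scope ring_scope.
Local Open Scope complex_scope.

(** Write u for ustar and perturb it to Pi (e^{eY}) u with a small e > 0. Seen in
    the frame moving with the symmetry solution, the perturbed solution is
    v s = Pi (e^{-sX} e^{eY} e^{sX}) u = Pi (exp (e Ad_s Y)) u, where
    Ad_s Y = e^{-sX} Y e^{sX}. Since u lies in the domain of every pi Z, the
    curve v stays in the domain of the linearized operator, and the equivariance of A
    and F together with the stationary equation pi X u = A u + F u
    ([stationary_equation]) shows that w = v - u satisfies
        w' = (A - pi X + F'(u)) w + (F (u + w) - F u - F'(u) w).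
    The last term is at most eta |w| as soon as w is small, which holds uniformly
    on [0, t] because e^{-sX} e^{eY} e^{sX} tends to 1 uniformly
    ([flow_conj_near1]). Hence w t differs from S t (w 0) by at most a constant
    times eta |w 0| ([comoving_estimate], from [perturbation_estimate]). Dividing
    by e and letting e tend to 0 turns w t into pi (Ad_t Y) u and w 0 into
    pi Y u, so the two sides of the claim differ by at most a constant times eta,
    for every small eta > 0.

    No integral is used: the variation of constants formula is replaced by a
    mean value inequality for s |-> S (t - s) (w s), which needs only left
    difference quotients ([mean_value_left], [duhamel_estimate]).

    The equality e^{tL} Y = e^{-tX} Y e^{tX} holds already for matrices: L is the
    difference of right and left multiplication by X, which commute, so its
    exponential factors ([exp_sandwich]). That the result belongs to the Lie
    algebra follows from exp (s g Y g^-1) = g exp (s Y) g^-1. *)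

(** * A real-valued matrix norm *)

(** The topology of complex matrices is given by balls with complex radii. This
    norm is real-valued, so that exponential series can be compared with the
    real exponential, and summing over all entries makes it submultiplicative
    without a dimension factor. *)
Definition mxl1 (R : realType) (m n : nat) (M : 'M[R[i]]_(m, n)) : R :=
  \sum_i \sum_j Normc.normc (M i j).

Lemma normc_ge0 (R : realType) (z : R[i]) : 0 <= Normc.normc z.
Proof. by case: z => a b; rewrite /= sqrtr_ge0. Qed.

Lemma normc_real (R : realType) (a : R) : Normc.normc a%:C = `|a|.
Proof. by rewrite /= expr0n addr0 sqrtr_sqr. Qed.

Lemma mxl1_ge0 (R : realType) (m n : nat) (M : 'M[R[i]]_(m, n)) : 0 <= mxl1 M.
Proof. by apply: sumr_ge0 => i _; apply: sumr_ge0 => j _; exact: normc_ge0. Qed.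

Lemma normc_le_mxl1 (R : realType) (m n : nat) (M : 'M[R[i]]_(m, n))
    (i : 'I_m) (j : 'I_n) :
  Normc.normc (M i j) <= mxl1 M.
Proof.
rewrite /mxl1 (bigD1 i)//= (bigD1 j)//= -addrA lerDl.
apply: addr_ge0; first by apply: sumr_ge0 => l _; exact: normc_ge0.
by apply: sumr_ge0 => l _; apply: sumr_ge0 => l' _; exact: normc_ge0.
Qed.

Lemma mxl10 (R : realType) (m n : nat) : mxl1 (0 : 'M[R[i]]_(m, n)) = 0.
Proof.
by apply: big1 => i _; apply: big1 => j _; rewrite mxE Normc.normc0.
Qed.

Lemma mxl1D (R : realType) (m n : nat) (M P : 'M[R[i]]_(m, n)) :
  mxl1 (M + P) <= mxl1 M + mxl1 P.
Proof.
rewrite /mxl1 -big_split; apply: ler_sum => i _.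
by rewrite -big_split; apply: ler_sum => j _; rewrite mxE; exact: le_normcD.
Qed.

Lemma mxl1N (R : realType) (m n : nat) (M : 'M[R[i]]_(m, n)) :
  mxl1 (- M) = mxl1 M.
Proof.
by apply: eq_bigr => i _; apply: eq_bigr => j _; rewrite mxE; exact: normcN.
Qed.

Lemma mxl1Z (R : realType) (m n : nat) (a : R) (M : 'M[R[i]]_(m, n)) :
  mxl1 (a%:C *: M) = `|a| * mxl1 M.
Proof.
rewrite /mxl1 mulr_sumr; apply: eq_bigr => i _.
rewrite mulr_sumr; apply: eq_bigr => j _.
by rewrite mxE Normc.normcM normc_real.
Qed.

Lemma mxl1_sum (R : realType) (m n : nat) (I : Type) (r : seq I) (P : pred I)
    (f : I -> 'M[R[i]]_(m, n)) :
  mxl1 (\sum_(k <- r | P k) f k) <= \sum_(k <- r | P k) mxl1 (f k).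
Proof.
elim/big_ind2 : _ => [|a x b y ax byy|//]; first by rewrite mxl10.
by apply: le_trans (mxl1D _ _) _; exact: lerD.
Qed.

Lemma mxl1M (R : realType) (m n p : nat) (M : 'M[R[i]]_(m, n))
    (P : 'M[R[i]]_(n, p)) :
  mxl1 (M *m P) <= mxl1 M * mxl1 P.
Proof.
rewrite /mxl1 mulr_suml; apply: ler_sum => i _.
have le1 j : Normc.normc ((M *m P) i j) <=
    \sum_k Normc.normc (M i k) * Normc.normc (P k j).
  rewrite mxE; elim/big_ind2 : _ => [|a x b y ax byy|k _].
  - by rewrite Normc.normc0.
  - by apply: le_trans (le_normcD _ _) _; exact: lerD.
  - by rewrite Normc.normcM.
apply: le_trans (ler_sum _ (fun j _ => le1 j)) _.
rewrite exchange_big mulr_suml; apply: ler_sum => k _ /=.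
rewrite -mulr_sumr; apply: ler_wpM2l; first exact: normc_ge0.
rewrite [leRHS](bigD1 k)//= lerDl; apply: sumr_ge0 => l _.
by apply: sumr_ge0 => j _; exact: normc_ge0.
Qed.

(** The identity matrix has norm n rather than 1, hence the factor, which the
    exponent 0 forces. *)
Lemma mxl1X (R : realType) (n : nat) (Y : 'M[R[i]]_n) (k : nat) :
  mxl1 (Y ^+ k) <= mxl1 (1%:M : 'M[R[i]]_n) * mxl1 Y ^+ k.
Proof.
elim: k => [|k IH]; first by rewrite !expr0 mulr1.
rewrite !exprS mulrCA; apply: le_trans (mxl1M _ _) _.
by apply: ler_wpM2l IH; exact: mxl1_ge0.
Qed.

(** A positive complex radius is real, so balls for the sup norm of the entries
    contain balls for the real-valued norm. *)
Lemma nbhs_mxl1 (R : realType) (n : nat) (M : 'M[R[i]]_n) (B : set 'M[R[i]]_n) :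
  nbhs M B -> exists2 d : R, 0 < d & forall P, mxl1 (P - M) < d -> B P.
Proof.
rewrite -nbhs_ballE => -[e /= e0 eB].
have eE : e = (complex.Re e)%:C.
  by rewrite RRe_real// ger0_real// ltW.
have re0 : 0 < complex.Re e by rewrite -ltcR -eE.
exists (complex.Re e) => // P PM; apply: eB.
split => // i j; rewrite /ball /=.
rewrite eE distrC normc_def ltcR; apply: le_lt_trans PM.
have -> : Num.sqrt (complex.Re (P i j - M i j) ^+ 2 +
    complex.Im (P i j - M i j) ^+ 2) = Normc.normc ((P - M) i j).
  by rewrite !mxE; case: (P i j - M i j).
exact: normc_le_mxl1.
Qed.

(** The exponentials to be computed are limits in the matrix topology; this
    reduces each of them to a convergence of real numbers. *)
Lemma mxl1_lim (R : realType) (n : nat) (f : nat -> 'M[R[i]]_n)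
    (l : 'M[R[i]]_n) :
  mxl1 (f k - l) @[k --> \oo] --> (0 : R) -> lim (f @ \oo) = l.
Proof.
move=> fl; apply: cvg_lim; first exact: norm_hausdorff.
move=> B /nbhs_mxl1[d d0 dB].
have /cvgr0Pnorm_lt/(_ d d0) := fl; apply: filterS => k /= kd.
by apply: dB; rewrite -[X in X < _]ger0_norm// mxl1_ge0.
Qed.

Lemma cvg_sum0 (R : realType) (I : finType) (f : I -> nat -> R) :
  (forall i, f i k @[k --> \oo] --> (0 : R)) ->
  (\sum_i f i k) @[k --> \oo] --> (0 : R).
Proof.
move=> f0.
have add_c : continuous (fun x : R * R => x.1 + x.2) by exact: add_continuous.
have := @cvg_big _ _ _ 0 xpredT add_c _ _ (index_enum I) f (fun=> 0) _
  (fun i _ => f0 i).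
by rewrite big1_eq; exact.
Qed.

(** Completeness, obtained from that of the reals: the real and imaginary parts
    of each entry form absolutely convergent series. *)
Lemma series_mxl1_cvg (R : realType) (m n : nat) (a : nat -> 'M[R[i]]_(m, n))
    (b : nat -> R) :
  (forall k, mxl1 (a k) <= b k) -> cvgn (series b) ->
  exists l, mxl1 (series a k - l) @[k --> \oo] --> (0 : R).
Proof.
move=> ab cb.
have nE k i j : Normc.normc (a k i j) <= b k.
  exact: le_trans (normc_le_mxl1 _ _ _) (ab k).
have ReN (z : R[i]) : `|complex.Re z| <= Normc.normc z.
  case: z => x y /=; rewrite -sqrtr_sqr ler_wsqrtr// lerDl; exact: sqr_ge0.
have ImN (z : R[i]) : `|complex.Im z| <= Normc.normc z.
  case: z => x y /=; rewrite -sqrtr_sqr ler_wsqrtr// lerDr; exact: sqr_ge0.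
have NRI (z : R[i]) : Normc.normc z <= `|complex.Re z| + `|complex.Im z|.
  case: z => x y /=.
  rewrite -[leRHS]ger0_norm ?addr_ge0// -sqrtr_sqr ler_wsqrtr//.
  rewrite sqrrD !real_normK ?num_real// lerD2r lerDl.
  by rewrite mulrn_wge0// mulr_ge0.
pose re i j := series (fun k => complex.Re (a k i j)).
pose im i j := series (fun k => complex.Im (a k i j)).
have cre i j : cvgn (re i j).
  apply: normed_cvg; apply: series_le_cvg cb => k //=.
  - by apply: le_trans (ab k); exact: mxl1_ge0.
  - by apply: le_trans (nE k i j).
have cim i j : cvgn (im i j).
  apply: normed_cvg; apply: series_le_cvg cb => k //=.
  - by apply: le_trans (ab k); exact: mxl1_ge0.
  - by apply: le_trans (nE k i j).
exists (\matrix_(i, j) (limn (re i j) +i* limn (im i j))).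
pose d i j k := `|re i j k - limn (re i j)| + `|im i j k - limn (im i j)|.
have d0 i j : d i j k @[k --> \oo] --> (0 : R).
  rewrite -[0 in X in _ --> X]addr0.
  by apply: cvgD; apply/norm_cvg0P/subr_cvg0.
have c0 : (\sum_i \sum_j d i j k) @[k --> \oo] --> (0 : R).
  apply: cvg_sum0 => i; exact: cvg_sum0.
apply: squeeze_cvgr (cvg_cst 0) c0.
near=> k; rewrite mxl1_ge0/=.
apply: ler_sum => i _; apply: ler_sum => j _.
have SE : series a k i j = re i j k +i* im i j k.
  rewrite /re /im /series /= summxE.
  by elim/big_rec3: _ => // l x y z _ ->; case: (a l i j).
by apply: le_trans (NRI _) _; rewrite !mxE SE.
Unshelve. all: by end_near. Qed.

(** * Cauchy products and matrix exponentials *)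

Lemma sum_antidiagonals (V : nmodType) (f : nat -> nat -> V) (N : nat) :
  \sum_(0 <= k < N) \sum_(0 <= j < k.+1) f (k - j)%N j =
  \sum_(0 <= j < N) \sum_(0 <= i < N - j) f i j.
Proof.
elim: N => [|N IH]; first by rewrite !big_nil.
rewrite big_nat_recr//= IH [RHS]big_nat_recr//= subSnn big_nat1.
rewrite [X in _ + X]big_nat_recr//= subnn addrA; congr (_ + _).
rewrite -big_split/=; apply: eq_big_nat => j /andP[_ jN].
by rewrite subSn 1?ltnW// [RHS]big_nat_recr.
Qed.

Lemma exp_coeffD (R : realType) (x y : R) (k : nat) :
  exp_coeff (x + y) k =
  \sum_(0 <= j < k.+1) exp_coeff x (k - j)%N * exp_coeff y j.
Proof.
rewrite /exp_coeff /= exprDn big_mkord mulr_suml; apply: eq_bigr => j _.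
have jk : (j <= k)%N by rewrite -ltnS.
have f0 l : (l`!%:R : R) != 0 by rewrite pnatr_eq0 -lt0n fact_gt0.
have <- := bin_fact jk; rewrite !natrM -mulr_natr.
by field; rewrite !f0/= pnatr_eq0 -lt0n bin_gt0.
Qed.

(** The product of two partial sums minus the partial sum of the Cauchy product is
    the sum over index pairs beyond an antidiagonal, and its norm is at most
    the same difference formed with the real exponential series, which tends
    to exp x * exp y - exp (x + y) = 0. *)
Lemma cauchy_product (R : realType) (n : nat) (a b : nat -> 'M[R[i]]_n)
    (A B : 'M[R[i]]_n) (Ka Kb x y : R) :
  0 <= Ka -> 0 <= Kb -> 0 <= x -> 0 <= y ->
  (forall k, mxl1 (a k) <= Ka * exp_coeff x k) ->
  (forall k, mxl1 (b k) <= Kb * exp_coeff y k) ->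
  mxl1 (series a k - A) @[k --> \oo] --> (0 : R) ->
  mxl1 (series b k - B) @[k --> \oo] --> (0 : R) ->
  mxl1 (series (fun k => \sum_(0 <= j < k.+1) a (k - j)%N *m b j) k - A *m B)
    @[k --> \oo] --> (0 : R).
Proof.
move=> Ka0 Kb0 x0 y0 aK bK aA bB.
pose c k := \sum_(0 <= j < k.+1) a (k - j)%N *m b j.
rewrite -/c.
have prodE (K : pzRingType) (f g : nat -> K) N : series f N * series g N =
    \sum_(0 <= j < N) \sum_(0 <= i < N) f i * g j.
  rewrite /series /= mulr_suml exchange_big/=; apply: eq_bigr => i _.
  by rewrite mulr_sumr.
have splitN (V : nmodType) (f : nat -> nat -> V) N :
    \sum_(0 <= j < N) \sum_(0 <= i < N) f i j =
    \sum_(0 <= j < N) \sum_(0 <= i < N - j) f i j +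
    \sum_(0 <= j < N) \sum_(N - j <= i < N) f i j.
  rewrite -big_split/=; apply: eq_bigr => j _.
  by rewrite -big_cat_nat//= leq_subr.
have tail N : mxl1 (series a N *m series b N - series c N) <=
    Ka * Kb * (series (exp_coeff x) N * series (exp_coeff y) N -
               series (exp_coeff (x + y)) N).
  have -> : series a N *m series b N - series c N =
      \sum_(0 <= j < N) \sum_(N - j <= i < N) a i *m b j.
    rewrite /series/= (sum_antidiagonals (fun i j => a i *m b j)).
    have -> : series a N *m series b N = series a N * series b N by [].
    rewrite prodE (splitN _ (fun i j => a i * b j)).
    by rewrite addrAC subrr add0r.
  have -> : series (exp_coeff x) N * series (exp_coeff y) N -
      series (exp_coeff (x + y)) N =
      \sum_(0 <= j < N) \sum_(N - j <= i < N) exp_coeff x i * exp_coeff y j.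
    rewrite /series/= (eq_bigr _ (fun k _ => exp_coeffD x y k)).
    rewrite (sum_antidiagonals (fun i j => exp_coeff x i * exp_coeff y j)).
    rewrite prodE (splitN _ (fun i j => exp_coeff x i * exp_coeff y j)).
    by rewrite addrAC subrr add0r.
  rewrite mulr_sumr; apply: le_trans (mxl1_sum _ _ _) _; apply: ler_sum => j _.
  rewrite mulr_sumr; apply: le_trans (mxl1_sum _ _ _) _; apply: ler_sum => i _.
  by apply: le_trans (mxl1M _ _) _; rewrite mulrACA ler_pM ?mxl1_ge0.
have tail0 : Ka * Kb * (series (exp_coeff x) N * series (exp_coeff y) N -
    series (exp_coeff (x + y)) N) @[N --> \oo] --> (0 : R).
  have -> : (0 : R) = Ka * Kb * (expR x * expR y - expR (x + y)).
    by rewrite expRD subrr mulr0.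
  have ce z : series (exp_coeff z) N @[N --> \oo] --> expR z.
    exact: is_cvg_series_exp_coeff.
  by apply: cvgMl_tmp; apply: cvgB; [apply: cvgM; exact: ce|exact: ce].
have maj0 : (Ka * Kb * (series (exp_coeff x) N * series (exp_coeff y) N -
      series (exp_coeff (x + y)) N) +
    (mxl1 (series a N - A) * (mxl1 (series b N - B) + mxl1 B) +
     mxl1 A * mxl1 (series b N - B))) @[N --> \oo] --> (0 : R).
  have -> : (0 : R) = 0 + (0 * (0 + mxl1 B) + mxl1 A * 0) by ring.
  apply: cvgD => //; apply: cvgD; last exact: cvgMl_tmp.
  by apply: cvgM => //; apply: cvgD => //; exact: cvg_cst.
apply: squeeze_cvgr (cvg_cst 0) maj0.
near=> N; rewrite mxl1_ge0/=.
have -> : series c N - A *m B = - (series a N *m series b N - series c N) +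
    ((series a N - A) *m series b N + A *m (series b N - B)).
  by rewrite mulmxBl mulmxBr [X in _ = _ + X]addrA subrK opprB addrA subrK.
apply: le_trans (mxl1D _ _) _; rewrite mxl1N; apply: lerD => //.
apply: le_trans (mxl1D _ _) _; apply: lerD; last exact: mxl1M.
apply: le_trans (mxl1M _ _) _; apply: ler_wpM2l; first exact: mxl1_ge0.
by rewrite -[X in mxl1 X <= _](subrK B); exact: mxl1D.
Unshelve. all: by end_near. Qed.

Lemma mxl1_cvgM (R : realType) (n : nat) (P Q l : 'M[R[i]]_n)
    (f : nat -> 'M[R[i]]_n) :
  mxl1 (f k - l) @[k --> \oo] --> (0 : R) ->
  mxl1 (P *m f k *m Q - P *m l *m Q) @[k --> \oo] --> (0 : R).
Proof.
move=> fl.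
have h0 : mxl1 P * mxl1 (f k - l) * mxl1 Q @[k --> \oo] --> (0 : R).
  rewrite -(mul0r (mxl1 Q)) -(mulr0 (mxl1 P)).
  by apply: cvgMr_tmp; exact: cvgMl_tmp.
apply: squeeze_cvgr (cvg_cst 0) h0; near=> k; apply/andP; split.
  exact: mxl1_ge0.
rewrite -mulmxBl -mulmxBr; apply: le_trans (mxl1M _ _) _.
by apply: ler_wpM2r; [exact: mxl1_ge0|exact: mxl1M].
Unshelve. all: by end_near. Qed.

Lemma scaled_invfactS (R : realType) (V : lmodType R[i]) (k : nat) (x : V) :
  k.+1%:R *: (k.+1`!%:R^-1 *: x) = k`!%:R^-1 *: x.
Proof.
by rewrite scalerA factS natrM invfM mulrA divff ?mul1r.
Qed.

Lemma invfactC (R : realType) (k : nat) :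
  (k`!%:R^-1 : R[i]) = (k`!%:R^-1 : R)%:C.
Proof. by rewrite fmorphV rmorph_nat. Qed.

Lemma expmx_term_le (R : realType) (n : nat) (Y : 'M[R[i]]_n) (k : nat) :
  mxl1 (k`!%:R^-1 *: Y ^+ k) <=
  mxl1 (1%:M : 'M[R[i]]_n) * exp_coeff (mxl1 Y) k.
Proof.
rewrite invfactC mxl1Z ger0_norm ?invr_ge0// /exp_coeff /=.
rewrite mulrA [leRHS]mulrC; apply: ler_wpM2l; first by rewrite invr_ge0.
exact: mxl1X.
Qed.

Lemma expmx_cvg (R : realType) (n : nat) (Y : 'M[R[i]]_n) :
  mxl1 (series (fun k => k`!%:R^-1 *: Y ^+ k) N - expmx Y) @[N --> \oo]
    --> (0 : R).
Proof.
have [|l hl] := series_mxl1_cvg (expmx_term_le Y).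
  have -> : series (fun k => mxl1 (1%:M : 'M[R[i]]_n) * exp_coeff (mxl1 Y) k) =
      (fun N => mxl1 (1%:M : 'M[R[i]]_n) * series (exp_coeff (mxl1 Y)) N).
    by apply/funext => N; rewrite /series /= mulr_sumr.
  by apply: is_cvgMr; exact: is_cvg_series_exp_coeff.
by rewrite /expmx (mxl1_lim hl).
Qed.

(** Left multiplication by A commutes with right multiplication by B, so the
    exponential of their sum applied to Y is e^A Y e^B. The case Y = 1 is the
    group law of one-parameter subgroups, and the case A = - tX, B = tX
    identifies the power series e^{tL} Y for L Z = [Z, X]. *)
Lemma exp_sandwich (R : realType) (n : nat) (A B Y : 'M[R[i]]_n) :
  mxl1 (series (fun k => k`!%:R^-1 *: iter k (fun Z => A *m Z + Z *m B) Y) N -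
        expmx A *m Y *m expmx B) @[N --> \oo] --> (0 : R).
Proof.
pose a k := k`!%:R^-1 *: A ^+ k.
pose b k := Y *m (k`!%:R^-1 *: B ^+ k).
pose c k := \sum_(0 <= j < k.+1) a (k - j)%N *m b j.
(* The Cauchy product satisfies the recursion (k + 1) c_{k+1} = A c_k + c_k B,
   obtained by splitting k + 1 = (k + 1 - j) + j in each summand. *)
have aS k : k.+1%:R *: a k.+1 = A *m a k.
  by rewrite /a scaled_invfactS exprS scalemxAr.
have bS k : k.+1%:R *: b k.+1 = b k *m B.
  by rewrite /b scalemxAr scaled_invfactS exprSr -mulmxA scalemxAl.
have cS k : k.+1%:R *: c k.+1 = A *m c k + c k *m B.
  rewrite /c scaler_sumr.
  have -> : \sum_(0 <= j < k.+2) k.+1%:R *: (a (k.+1 - j)%N *m b j) =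
      \sum_(0 <= j < k.+2) (k.+1 - j)%:R *: (a (k.+1 - j)%N *m b j) +
      \sum_(0 <= j < k.+2) j%:R *: (a (k.+1 - j)%N *m b j).
    rewrite -big_split/=; apply: eq_big_nat => j /andP[_ jk].
    by rewrite -scalerDl -natrD subnK.
  congr (_ + _).
    rewrite big_nat_recr//= subnn scale0r addr0 mulmx_sumr.
    apply: eq_big_nat => j /andP[_ jk].
    by rewrite subSn// scalemxAl aS -mulmxA.
  rewrite big_nat_recl//= scale0r add0r mulmx_suml.
  by apply: eq_bigr => j _; rewrite subSS scalemxAr bS [LHS]mulmxA.
have cE k : k`!%:R^-1 *: iter k (fun Z => A *m Z + Z *m B) Y = c k.
  elim: k => [|k IH].
    by rewrite /c big_nat1 /a /b !expr0 invr1 !scale1r mul1mx mulmx1.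
  apply: (@scalerI _ _ (k.+1%:R)); first by rewrite pnatr_eq0.
  by rewrite scaled_invfactS cS -IH iterS scalerDr scalemxAr scalemxAl.
have -> : (fun k => k`!%:R^-1 *: iter k (fun Z => A *m Z + Z *m B) Y) = c.
  by apply/funext => k.
rewrite -mulmxA.
apply: (@cauchy_product _ _ a b (expmx A) (Y *m expmx B)
  (mxl1 (1%:M : 'M[R[i]]_n)) (mxl1 Y * mxl1 (1%:M : 'M[R[i]]_n))
  (mxl1 A) (mxl1 B)); rewrite ?mulr_ge0 ?mxl1_ge0//.
- by move=> k; exact: expmx_term_le.
- move=> k; apply: le_trans (mxl1M _ _) _; rewrite -mulrA.
  by apply: ler_wpM2l; [exact: mxl1_ge0|exact: expmx_term_le].
- exact: expmx_cvg.
have -> : series b =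
    (fun N => Y *m series (fun k => k`!%:R^-1 *: B ^+ k) N *m 1%:M).
  by apply/funext => N; rewrite mulmx1 /series /= mulmx_sumr.
by rewrite -[Y *m expmx B]mulmx1; apply: mxl1_cvgM; exact: expmx_cvg.
Qed.

Lemma expmx_sum (R : realType) (n : nat) (A B : 'M[R[i]]_n) :
  A *m B = B *m A -> expmx (A + B) = expmx A *m expmx B.
Proof.
move=> AB; rewrite -[X in X *m _]mulmx1 [LHS]/expmx.
apply: mxl1_lim; have := exp_sandwich A B 1%:M.
suff -> : (fun k => k`!%:R^-1 *: iter k (fun Z => A *m Z + Z *m B) 1%:M) =
  (fun k => k`!%:R^-1 *: (A + B) ^+ k) by [].
apply/funext => k; congr (_ *: _); elim: k => // k IH.
have comB : GRing.comm B (A + B) by rewrite /GRing.comm mulrDl mulrDr [A * B]AB.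
by rewrite iterS IH exprS [RHS]mulrDl; congr (_ + _); rewrite [RHS]commrX.
Qed.

Lemma expmx0 (R : realType) (n : nat) : expmx (0 : 'M[R[i]]_n) = 1%:M.
Proof.
rewrite /expmx; apply: mxl1_lim; apply: cvg_near_cst.
exists 1%N => // -[//|N] _ /=.
rewrite /series /= big_nat_recl//= expr0 invr1 scale1r big1.
  by rewrite addr0 subrr mxl10.
by move=> k _; rewrite exprS mul0r scaler0.
Qed.

Lemma exp_linE (R : realType) (n : nat) (X Y : 'M[R[i]]_n) (t : R) :
  exp_lin t (fun Z => lie_bracket Z X) Y =
  expmx (- t%:C *: X) *m Y *m expmx (t%:C *: X).
Proof.
rewrite /exp_lin; apply: mxl1_lim.
have := exp_sandwich (- t%:C *: X) (t%:C *: X) Y.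
suff -> : (fun k => k`!%:R^-1 *:
      iter k (fun Z => - t%:C *: X *m Z + Z *m (t%:C *: X)) Y) =
    (fun k => (t ^+ k / k`!%:R)%:C *: iter k (fun Z => lie_bracket Z X) Y) by [].
apply/funext => k; rewrite [t ^+ k / _]mulrC rmorphM/= -invfactC -scalerA.
congr (_ *: _); elim: k => [|k IH]; first by rewrite expr0 scale1r.
rewrite !iterS IH exprS rmorphM -scalerA /lie_bracket.
by rewrite -scalemxAl -!scalemxAr -scalemxAl scaleNr scalerBr scalerBr addrC.
Qed.

Lemma expmx_conj (R : realType) (n : nat) (g Y : 'M[R[i]]_n) :
  g \in unitmx -> expmx (g *m Y *m invmx g) = g *m expmx Y *m invmx g.
Proof.
move=> gU; rewrite [LHS]/expmx; apply: mxl1_lim.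
have cX k : (g *m Y *m invmx g) ^+ k = g *m Y ^+ k *m invmx g.
  elim: k => [|k IH]; first by rewrite !expr0 mulmx1 mulmxV.
  rewrite !exprS IH; change (g *m Y *m invmx g *m (g *m Y ^+ k *m invmx g) =
    g *m (Y *m Y ^+ k) *m invmx g).
  by rewrite !mulmxA mulmxKV.
have -> : series (fun k => k`!%:R^-1 *: (g *m Y *m invmx g) ^+ k) =
    (fun N => g *m series (fun k => k`!%:R^-1 *: Y ^+ k) N *m invmx g).
  apply/funext => N; rewrite /series /= mulmx_sumr mulmx_suml.
  by apply: eq_bigr => k _; rewrite cX -scalemxAr -scalemxAl.
by apply: mxl1_cvgM; exact: expmx_cvg.
Qed.

Lemma mxl1_expmx_sub1 (R : realType) (n : nat) (Y : 'M[R[i]]_n) :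
  mxl1 (expmx Y - 1%:M) <= mxl1 (1%:M : 'M[R[i]]_n) * (expR (mxl1 Y) - 1).
Proof.
pose K := mxl1 (1%:M : 'M[R[i]]_n).
pose s := series (fun k => k`!%:R^-1 *: Y ^+ k).
pose e := series (exp_coeff (mxl1 Y)).
have le N : mxl1 (s N.+1 - 1%:M) <= K * (e N.+1 - 1).
  rewrite /s /e /series /= big_nat_recl// expr0 invr1 scale1r addrAC subrr add0r.
  rewrite big_nat_recl// [exp_coeff _ 0%N]/exp_coeff /= expr0 divr1.
  rewrite addrAC subrr add0r mulr_sumr; apply: le_trans (mxl1_sum _ _ _) _.
  by apply: ler_sum => k _; exact: expmx_term_le.
have h1 : (K * (e N - 1) + mxl1 (s N - expmx Y)) @[N --> \oo] -->
    K * (expR (mxl1 Y) - 1) + 0.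
  apply: cvgD; last exact: expmx_cvg.
  apply: cvgMl_tmp; apply: cvgB; last exact: cvg_cst.
  exact: is_cvg_series_exp_coeff.
rewrite -[leRHS]addr0; apply: (cvgr_to_ge h1).
near=> N.
have -> : expmx Y - 1%:M = (s N - 1%:M) - (s N - expmx Y).
  by rewrite opprB [RHS]addrC addrA subrK.
apply: le_trans (mxl1D _ _) _; rewrite mxl1N lerD2r.
have N0 : (0 < N)%N by near: N; exact: nbhs_infty_gt.
by rewrite -(prednK N0).
Unshelve. all: by end_near. Qed.

(** * Estimates for perturbed semigroup orbits *)

(** A one-sided mean value inequality: the infimum of the times s at which
    |z t - z s| <= (K + e) (t - s) satisfies this bound by right continuity, and
    if it were positive the left difference quotient would allow a smaller s.
    Left difference quotients suffice, which matters because semigroups can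
    only be differentiated forward in time. *)
Lemma mean_value_left (R : realType) (V : normedModType R) (z : R -> V)
    (t K : R) :
  0 <= t ->
  (forall s, 0 <= s < t -> z (s + h) @[h --> 0^'+] --> z s) ->
  (forall s, 0 < s <= t -> forall e, 0 < e ->
     \forall h \near 0^'+, `|z s - z (s - h)| <= (K + e) * h) ->
  `|z t - z 0| <= K * t.
Proof.
move=> t0 zc zd.
suff He e : 0 < e -> `|z t - z 0| <= (K + e) * t.
  apply/ler_addgt0Pr => e e0.
  have t1 : 0 < t + 1 by rewrite ltr_wpDl.
  apply: le_trans (He (e / (t + 1)) (divr_gt0 e0 t1)) _.
  rewrite mulrDl lerD2l mulrAC ler_pdivrMr// ler_pM2l//.
  by rewrite lerDl.
move=> e0.
pose B := [set s | 0 <= s <= t /\ `|z t - z s| <= (K + e) * (t - s)].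
have Bt : B t by rewrite /B/= t0 lexx !subrr normr0 mulr0.
have hiB : has_inf B.
  by split; [exists t|exists 0 => s [/andP[]]].
pose m := inf B.
have m0 : 0 <= m by apply: lb_le_inf; [exists t|move=> s [/andP[]]].
have mt : m <= t by apply: ge_inf => //; case: hiB.
have Bm : B m.
  split; first by rewrite m0.
  rewrite leNgt; apply/negP => lt_m.
  have [mltt|tm] := ltP m t; last first.
    have mE : m = t by apply/eqP; rewrite eq_le mt.
    by move: lt_m; rewrite mE !subrr normr0 mulr0 ltxx.
  have hc : (`|z t - z (m + h)| - (K + e) * (t - (m + h))) @[h --> 0^'+] -->
      `|z t - z m| - (K + e) * (t - (m + 0)).
    apply: cvgB.
      apply: cvg_norm; apply: cvgB; first exact: cvg_cst.
      by apply: zc; rewrite m0.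
    apply: cvgMl_tmp; apply: cvgB; first exact: cvg_cst.
    apply: cvgD; first exact: cvg_cst.
    exact: cvg_at_right_filter.
  have gt0 : 0 < `|z t - z m| - (K + e) * (t - (m + 0)).
    by rewrite addr0 subr_gt0.
  have [d /= d0 dP] := cvgr_gt _ hc _ gt0.
  have [s Bs sm] := inf_adherent d0 hiB.
  have ms : m <= s by apply: ge_inf => //; case: hiB.
  case: Bs => _ Bs.
  have [smE|sm'] := eqVneq s m; first by move: Bs; rewrite smE leNgt lt_m.
  have ms' : 0 < s - m by rewrite subr_gt0 lt_neqAle eq_sym sm'.
  have sE : m + (s - m) = s by rewrite addrC subrK.
  have sd : `|0 - (s - m)| < d by rewrite sub0r normrN gtr0_norm// ltrBlDl.
  by have := dP _ sd ms'; rewrite /= sE subr_gt0 ltNge Bs.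
have [m_eq0|mn0] := eqVneq m 0; first by move: Bm => [_]; rewrite m_eq0 subr0.
have mgt0 : 0 < m by rewrite lt_neqAle eq_sym mn0.
have mI : 0 < m <= t by rewrite mgt0.
near (0 : R)^'+ => h.
have h0 : 0 < h by near: h; exact: nbhs_right_gt.
have hm : h < m by near: h; exact: nbhs_right_lt.
have zh : `|z m - z (m - h)| <= (K + e) * h by near: h; exact: zd.
suff Bmh : B (m - h).
  have : m <= m - h by apply: ge_inf => //; case: hiB.
  by rewrite lerBrDr gerDl leNgt h0.
split; first by rewrite subr_ge0 ltW//= lerBlDr ler_wpDr// ltW.
have -> : z t - z (m - h) = (z t - z m) + (z m - z (m - h)).
  by rewrite addrA subrK.
apply: le_trans (ler_normD _ _) _.
have -> : (K + e) * (t - (m - h)) = (K + e) * (t - m) + (K + e) * h by ring.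
by apply: lerD => //; case: Bm.
Unshelve. all: by end_near. Qed.

(** In A a (f a) = A a (f a - x) + A a x the first term is at most M |f a - x|. *)
Lemma cvg_bounded_family (R : realType) (V : normedModType R) (T : Type)
    (F : set_system T) (FF : Filter F) (A : T -> {linear V -> V}) (M : R)
    (f : T -> V) (x y : V) :
  (\forall a \near F, forall v, `|A a v| <= M * `|v|) ->
  f a @[a --> F] --> x -> A a x @[a --> F] --> y ->
  A a (f a) @[a --> F] --> y.
Proof.
move=> AM fx Ax.
have h0 : (M * `|f a - x|) @[a --> F] --> (0 : R).
  rewrite -(mulr0 M); apply: cvgMl_tmp; apply/norm_cvg0P.
  exact/subr_cvg0.
rewrite -[y]add0r.
have -> : (fun a => A a (f a)) = (fun a => A a (f a - x) + A a x).
  by apply/funext => a; rewrite -linearD subrK.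
apply: cvgD => //; apply/norm_cvg0P.
apply: squeeze_cvgr (cvg_cst 0) h0.
by apply: filterS AM => a Aa; rewrite normr_ge0 Aa.
Qed.

(** An integral-free form of Duhamel's formula. The curve z s = S (t - s) (w s)
    runs from S t (w 0) to w t, and
    z s - z (s - h) = S (t - s) (S h (w s - w (s - h)) - (S h (w s) - w s)),
    so that its left derivative is S (t - s) applied to the defect
    w' - generator S w; only S h with h > 0 is ever differentiated. *)
Lemma duhamel_estimate (R : realType) (V : completeNormedModType R)
    (S : R -> {linear V -> V}) (M K t : R) (w dw : R -> V) :
  C0_semigroup S -> 0 <= M ->
  (forall s, 0 <= s -> forall x, `|S s x| <= M * `|x|) ->
  0 <= t ->
  (forall s, 0 <= s < t -> w (s + h) @[h --> 0^'+] --> w s) ->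
  (forall s, 0 < s <= t -> dom (generator S) (w s)) ->
  (forall s, 0 < s <= t -> h^-1 *: (w s - w (s - h)) @[h --> 0^'+] --> dw s) ->
  (forall s, 0 < s <= t -> `|dw s - generator S (w s)| <= K) ->
  `|w t - S t (w 0)| <= M * K * t.
Proof.
move=> [Sc S0 SD Scv] M0 SM t0 wr wdom wd wK.
pose z s := S (t - s) (w s).
have -> : w t - S t (w 0) = z t - z 0 by rewrite /z subrr S0 subr0.
apply: mean_value_left => // [s /andP[s0 st]|s /andP[s0 st] e e0].
  have Scs : S h (w s) @[h --> 0^'+] --> w s by exact: Scv.
  have h0 : (M * `|w (s + h) - w s| + M * `|w s - S h (w s)|) @[h --> 0^'+]
      --> M * 0 + M * 0.
    apply: cvgD; apply: cvgMl_tmp; apply/norm_cvg0P.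
      by apply/subr_cvg0; apply: wr; rewrite s0.
    by rewrite -(subrr (w s)); apply: cvgB => //; exact: cvg_cst.
  rewrite mulr0 addr0 in h0.
  apply/subr_cvg0/norm_cvg0P.
  apply: squeeze_cvgr (cvg_cst 0) h0.
  near=> h; rewrite normr_ge0/=.
  have hgt0 : 0 < h by near: h; exact: nbhs_right_gt.
  have hts : h < t - s by near: h; apply: nbhs_right_lt; rewrite subr_gt0.
  have rt : 0 <= t - (s + h) by rewrite opprD addrA subr_ge0 ltW.
  have -> : z (s + h) - z s =
      S (t - (s + h)) (w (s + h) - w s) + S (t - (s + h)) (w s - S h (w s)).
    rewrite /z (_ : t - s = t - (s + h) + h); last by rewrite opprD addrA subrK.
    by rewrite (SD _ _ rt (ltW hgt0)) !linearB/= addrA subrK.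
  by apply: le_trans (ler_normD _ _) _; apply: lerD; exact: SM.
have sI : 0 < s <= t by rewrite s0.
have Sh0 : \forall h \near (0 : R)^'+, forall v, `|S h v| <= M * `|v|.
  near=> h; apply: SM; apply: ltW; near: h; exact: nbhs_right_gt.
pose q h := S h (h^-1 *: (w s - w (s - h))) - h^-1 *: (S h (w s) - w s).
have qc : q h @[h --> 0^'+] --> dw s - generator S (w s).
  apply: cvgB; last exact: wdom.
  exact: (cvg_bounded_family _ Sh0 (wd _ sI) (Scv (dw s))).
have zq h : 0 < h -> z s - z (s - h) = h *: S (t - s) (q h).
  move=> h0.
  have -> : z (s - h) = S (t - s) (S h (w (s - h))).
    by rewrite -SD ?subr_ge0// ?(ltW h0)// /z opprB addrA addrAC.
  rewrite /z /q -linearB -linearZ/=; congr (S _ _).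
  rewrite scalerBr [S h (_ *: _)]linearZ/= !scalerA divff ?gt_eqF// !scale1r.
  by rewrite linearB/= opprB [RHS]addrC addrA subrK.
have Kq : `|dw s - generator S (w s)| < K + e / (M + 1).
  apply: le_lt_trans (wK _ sI) _.
  by rewrite ltrDl divr_gt0// ltr_wpDl.
have qn : \forall h \near 0^'+, `|q h| < K + e / (M + 1).
  exact: cvgr_lt _ (cvg_norm qc) _ Kq.
near=> h.
have h0 : 0 < h by near: h; exact: nbhs_right_gt.
rewrite zq// normrZ gtr0_norm// mulrC ler_pM2r//.
have ts : 0 <= t - s by rewrite subr_ge0.
apply: le_trans (SM _ ts _) _.
have qh : `|q h| < K + e / (M + 1) by near: h; exact: qn.
apply: le_trans (ler_wpM2l M0 (ltW qh)) _.
rewrite mulrDr lerD2l mulrCA -[leRHS]mulr1 ler_pM2l//.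
by rewrite ler_pdivrMr ?ltr_wpDl// mul1r lerDl.
Unshelve. all: by end_near. Qed.

(** When the defect is at most eta |w|, the Duhamel estimate bounds the supremum
    W of |w| by M |w 0| + W / 2, hence by 2 M |w 0|; inserting this bound into
    the Duhamel estimate once more gives a factor eta. The bound B makes W
    finite. *)
Lemma perturbation_estimate (R : realType) (V : completeNormedModType R)
    (S : R -> {linear V -> V}) (M eta B t : R) (w dw : R -> V) :
  C0_semigroup S -> 0 <= M ->
  (forall s, 0 <= s -> forall x, `|S s x| <= M * `|x|) ->
  0 <= eta -> 0 <= t -> M * eta * t <= 2^-1 ->
  (forall s, 0 <= s <= t -> `|w s| <= B) ->
  (forall s, 0 <= s < t -> w (s + h) @[h --> 0^'+] --> w s) ->
  (forall s, 0 < s <= t -> dom (generator S) (w s)) ->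
  (forall s, 0 < s <= t -> h^-1 *: (w s - w (s - h)) @[h --> 0^'+] --> dw s) ->
  (forall s, 0 < s <= t -> `|dw s - generator S (w s)| <= eta * `|w s|) ->
  `|w t - S t (w 0)| <= 2 * M ^+ 2 * t * `|w 0| * eta.
Proof.
move=> SS M0 SM eta0 t0 small wB wr wdom wd wK.
pose E := [set `|w s| | s in [set s | 0 <= s <= t]].
have hsE : has_sup E.
  split; first by exists `|w 0|; exists 0 => //=; rewrite lexx.
  by exists B => _ [s st <-]; exact: wB.
pose W := sup E.
have wW s : 0 <= s <= t -> `|w s| <= W.
  by move=> st; apply: sup_upper_bound => //; exists s.
have W0 : 0 <= W by apply: le_trans (wW 0 _); rewrite ?lexx.
have est s : 0 <= s <= t -> `|w s - S s (w 0)| <= M * (eta * W) * s.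
  move=> /andP[s0 st].
  apply: (duhamel_estimate (dw := dw)) => //.
  - by move=> r /andP[r0 rs]; apply: wr; rewrite r0 (lt_le_trans rs).
  - by move=> r /andP[r0 rs]; apply: wdom; rewrite r0 (le_trans rs).
  - by move=> r /andP[r0 rs]; apply: wd; rewrite r0 (le_trans rs).
  - move=> r /andP[r0 rs]; apply: le_trans (wK _ _) _.
      by rewrite r0 (le_trans rs).
    by apply: ler_wpM2l => //; apply: wW; rewrite ltW//= (le_trans rs).
have WM : W <= 2 * (M * `|w 0|).
  suff : W <= M * `|w 0| + 2^-1 * W by lra.
  apply: ge_sup => [|_ [s sI <-]]; first by case: hsE.
  have /andP[s0 st] := sI.
  rewrite -[w s](subrK (S s (w 0))); apply: le_trans (ler_normD _ _) _.
  rewrite addrC; apply: lerD; first exact: SM.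
  apply: le_trans (est s sI) _; apply: le_trans (ler_wpM2r W0 small).
  rewrite mulrA mulrAC; apply: ler_wpM2r => //.
  by apply: ler_wpM2l => //; exact: mulr_ge0.
have tI : 0 <= t <= t by rewrite t0 lexx.
apply: le_trans (est t tI) _.
have -> : 2 * M ^+ 2 * t * `|w 0| * eta = M * (eta * (2 * (M * `|w 0|))) * t.
  by ring.
by apply: ler_wpM2r => //; do 2! apply: ler_wpM2l => //.
Qed.

Lemma generatorB (R : realType) (V : completeNormedModType R)
    (S : R -> {linear V -> V}) (x y : V) :
  dom (generator S) x -> dom (generator S) y ->
  dom (generator S) (x - y) /\
  generator S (x - y) = generator S x - generator S y.
Proof.
move=> dx dy.
have : h^-1 *: (S h (x - y) - (x - y)) @[h --> 0^'+] -->
    generator S x - generator S y.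
  have -> : (fun h => h^-1 *: (S h (x - y) - (x - y))) =
      (fun h => h^-1 *: (S h x - x) - h^-1 *: (S h y - y)).
    apply/funext => h; rewrite [S h (x - y)]linearB -[RHS]scalerBr/=.
    by rewrite opprD addrACA -opprD.
  by apply: cvgB; [exact: dx|exact: dy].
move=> c; split; first exact: cvgP c.
by apply: cvg_lim c; exact: norm_hausdorff.
Qed.

Lemma differentiable_remainder (R : realType) (V W : normedModType R)
    (F : V -> W) (u : V) (eta : R) :
  differentiable F u -> 0 < eta ->
  exists2 d, 0 < d & forall w, `|w| <= d ->
    `|F (u + w) - F u - 'd F u w| <= eta * `|w|.
Proof.
move=> dF eta0.
have /eqaddoP/(_ eta eta0) := diff_locally dF.
move=> /nbhs_ballP[d /= d0 dP].
exists (d / 2); first exact: divr_gt0.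
move=> w wd.
have /dP : ball (0 : V) d w.
  rewrite -ball_normE /= sub0r normrN; apply: le_lt_trans wd _.
  by rewrite ltr_pdivrMr// ltr_pMr// ltr1n.
by rewrite /= !fctE /= opprD addrA [w + u]addrC.
Qed.

(** * One-parameter subgroups *)

(** The one-parameter subgroup with generator X. It is sealed because comparing
    two exponentials by unfolding the limits that define them is intractable. *)
HB.lock Definition flow (R : realType) (n : nat) (X : 'M[R[i]]_n) (t : R) :
    'M[R[i]]_n :=
  expmx (t%:C *: X).

Lemma flowE (R : realType) (n : nat) (X : 'M[R[i]]_n) (t : R) :
  expmx (t%:C *: X) = flow X t.
Proof. by rewrite flow.unlock. Qed.

Lemma flowD (R : realType) (n : nat) (X : 'M[R[i]]_n) (s t : R) :
  flow X (s + t) = flow X s *m flow X t.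
Proof.
rewrite -!flowE rmorphD scalerDl; apply: expmx_sum.
by rewrite -!scalemxAl -!scalemxAr !scalerA mulrC.
Qed.

Lemma flow0 (R : realType) (n : nat) (X : 'M[R[i]]_n) : flow X 0 = 1%:M.
Proof. by rewrite -flowE rmorph0 scale0r expmx0. Qed.

Lemma flowNK (R : realType) (n : nat) (X : 'M[R[i]]_n) (t : R) :
  flow X (- t) *m flow X t = 1%:M.
Proof. by rewrite -flowD addNr flow0. Qed.

Lemma flowKN (R : realType) (n : nat) (X : 'M[R[i]]_n) (t : R) :
  flow X t *m flow X (- t) = 1%:M.
Proof. by rewrite -flowD subrr flow0. Qed.

Lemma flow_unit (R : realType) (n : nat) (X : 'M[R[i]]_n) (t : R) :
  flow X t \in unitmx.
Proof. exact: (mulmx1_unit (flowKN X t)).1. Qed.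

Lemma invmx_flow (R : realType) (n : nat) (X : 'M[R[i]]_n) (t : R) :
  invmx (flow X t) = flow X (- t).
Proof.
by rewrite -[RHS]mulmx1 -(mulmxV (flow_unit X t)) mulmxA flowNK mul1mx.
Qed.

Lemma flow_conj (R : realType) (n : nat) (g Y : 'M[R[i]]_n) (t : R) :
  g \in unitmx -> flow (g *m Y *m invmx g) t = g *m flow Y t *m invmx g.
Proof.
move=> gU; rewrite -!flowE -(expmx_conj (t%:C *: Y) gU); congr expmx.
by rewrite -scalemxAr -scalemxAl.
Qed.

Lemma mxl1_flow_sub1 (R : realType) (n : nat) (X : 'M[R[i]]_n) (t : R) :
  mxl1 (flow X t - 1%:M) <=
  mxl1 (1%:M : 'M[R[i]]_n) * (expR (`|t| * mxl1 X) - 1).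
Proof.
by rewrite -flowE; apply: le_trans (mxl1_expmx_sub1 _) _; rewrite mxl1Z.
Qed.

Lemma mxl1_flow (R : realType) (n : nat) (X : 'M[R[i]]_n) (t : R) :
  mxl1 (flow X t) <= mxl1 (1%:M : 'M[R[i]]_n) * expR (`|t| * mxl1 X).
Proof.
rewrite -[flow X t](subrK 1%:M); apply: le_trans (mxl1D _ _) _.
have := mxl1_flow_sub1 X t; rewrite mulrBr mulr1; lra.
Qed.

Lemma flow_cvg1 (R : realType) (n : nat) (X : 'M[R[i]]_n) :
  mxl1 (flow X t - 1%:M) @[t --> (0 : R)] --> (0 : R).
Proof.
have h0 : (mxl1 (1%:M : 'M[R[i]]_n) * (expR (`|t| * mxl1 X) - 1))
    @[t --> (0 : R)] -->
    mxl1 (1%:M : 'M[R[i]]_n) * (expR (`|0 : R| * mxl1 X) - 1).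
  apply: cvgMl_tmp; apply: cvgB; last exact: cvg_cst.
  apply: continuous_cvg; first exact: continuous_expR.
  by apply: cvgMr_tmp; exact: cvg_norm.
rewrite normr0 mul0r expR0 subrr mulr0 in h0.
apply: squeeze_cvgr (cvg_cst 0) h0.
by near=> t; rewrite mxl1_ge0 mxl1_flow_sub1.
Unshelve. all: by end_near. Qed.

(** Uniformity in s holds because the conjugating elements stay in a bounded set
    while s ranges over a bounded interval. *)
Lemma flow_conj_near1 (R : realType) (n : nat) (X Y : 'M[R[i]]_n) (T d : R) :
  0 < d ->
  \forall e \near (0 : R), forall s, 0 <= s <= T ->
    mxl1 (flow X (- s) *m flow Y e *m flow X s - 1%:M) < d.
Proof.
move=> d0.
pose C := mxl1 (1%:M : 'M[R[i]]_n) * expR (T * mxl1 X).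
have h0 : (C * mxl1 (flow Y e - 1%:M) * C) @[e --> (0 : R)] --> C * 0 * C.
  by apply: cvgMr_tmp; apply: cvgMl_tmp; exact: flow_cvg1.
rewrite mulr0 mul0r in h0.
have hd : \forall e \near (0 : R), C * mxl1 (flow Y e - 1%:M) * C < d.
  exact: cvgr_lt h0 _ d0.
apply: filterS hd => e ed s /andP[s0 sT].
apply: le_lt_trans ed.
have -> : flow X (- s) *m flow Y e *m flow X s - 1%:M =
    flow X (- s) *m (flow Y e - 1%:M) *m flow X s.
  by rewrite mulmxBr mulmx1 mulmxBl flowNK.
have fC r : `|r| <= T -> mxl1 (flow X r) <= C.
  move=> rT; apply: le_trans (mxl1_flow _ _) _.
  apply: ler_wpM2l; first exact: mxl1_ge0.
  by rewrite ler_expR; apply: ler_wpM2r => //; exact: mxl1_ge0.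
apply: le_trans (mxl1M _ _) _; apply: ler_pM; rewrite ?mxl1_ge0//.
  apply: le_trans (mxl1M _ _) _; apply: ler_wpM2r; first exact: mxl1_ge0.
  by apply: fC; rewrite normrN ger0_norm.
by apply: fC; rewrite ger0_norm.
Qed.

Lemma lie_algebra_flow (R : realType) (n : nat) (G : set 'M[R[i]]_n)
    (Y : 'M[R[i]]_n) (t : R) :
  lie_algebra G Y -> G (flow Y t).
Proof. by move=> /(_ t); rewrite flowE. Qed.

Lemma lie_algebra_conj (R : realType) (n : nat) (G : set 'M[R[i]]_n)
    (g Y : 'M[R[i]]_n) :
  matrix_lie_group G -> G g -> lie_algebra G Y ->
  lie_algebra G (g *m Y *m invmx g).
Proof.
move=> [GU _ GM GV _] Gg GY t; rewrite flowE flow_conj; last exact: GU.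
by apply: (GM); [apply: GM; [|exact: lie_algebra_flow]|exact: GV].
Qed.

(** * Representations and their infinitesimal generators *)

(** Continuity at the identity is where the topology of the group enters; all
    further continuity follows by the group law and the uniform bound. *)
Lemma rep_continuous_at1 (R : realType) (V : completeNormedModType R) (n : nat)
    (G : set 'M[R[i]]_n) (Pi : 'M[R[i]]_n -> {linear V -> V}) (x : V) (e : R) :
  matrix_lie_group G -> is_representation G Pi -> strongly_continuous G Pi ->
  0 < e ->
  exists2 d, 0 < d &
    forall g, G g -> mxl1 (g - 1%:M) < d -> `|Pi g x - x| < e.
Proof.
move=> [_ G1 _ _ _] [_ Pi1 _] /(_ x)/subspace_continuousP/(_ _ G1) Pc e0.
have /cvgrPdist_lt/(_ _ e0)/nbhs_mxl1[d d0 dP] := Pc.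
by exists d => // g Gg /dP /(_ Gg); rewrite /from_subspace /= Pi1 distrC.
Qed.

Lemma rep_flow_cvg (R : realType) (V : completeNormedModType R) (n : nat)
    (G : set 'M[R[i]]_n) (Pi : 'M[R[i]]_n -> {linear V -> V})
    (X : 'M[R[i]]_n) (x : V) :
  matrix_lie_group G -> is_representation G Pi -> strongly_continuous G Pi ->
  lie_algebra G X -> Pi (flow X t) x @[t --> (0 : R)] --> x.
Proof.
move=> GG PiG Pc GX; apply/cvgrPdist_lt => e e0.
have [d d0 dP] := rep_continuous_at1 x GG PiG Pc e0.
have hd : \forall t \near (0 : R), mxl1 (flow X t - 1%:M) < d.
  exact: cvgr_lt (flow_cvg1 X) _ d0.
apply: filterS hd => t td.
by rewrite distrC; apply: dP => //; exact: lie_algebra_flow.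
Qed.

Lemma pi_op_cvg (R : realType) (V : completeNormedModType R) (n : nat)
    (Pi : 'M[R[i]]_n -> {linear V -> V}) (Y : 'M[R[i]]_n) (x y : V) :
  t^-1 *: (Pi (flow Y t) x - x) @[t --> (0 : R)^'] --> y ->
  dom (pi_op Pi Y) x /\ pi_op Pi Y x = y.
Proof.
have -> : (fun t => t^-1 *: (Pi (flow Y t) x - x)) =
    (fun t => t^-1 *: (Pi (expmx (t%:C *: Y)) x - x)).
  by apply/funext => t; rewrite flowE.
move=> c; split; first exact: cvgP c.
by apply: cvg_lim c; exact: norm_hausdorff.
Qed.

Lemma pi_op_domP (R : realType) (V : completeNormedModType R) (n : nat)
    (Pi : 'M[R[i]]_n -> {linear V -> V}) (Y : 'M[R[i]]_n) (x : V) :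
  dom (pi_op Pi Y) x ->
  t^-1 *: (Pi (flow Y t) x - x) @[t --> (0 : R)^'] --> pi_op Pi Y x.
Proof.
have -> : (fun t => t^-1 *: (Pi (flow Y t) x - x)) =
    (fun t => t^-1 *: (Pi (expmx (t%:C *: Y)) x - x)).
  by apply/funext => t; rewrite flowE.
exact.
Qed.

(** Pi (e^{tY}) Pi g = Pi g Pi (g^-1 e^{tY} g), and the last factor is the
    one-parameter subgroup generated by g^-1 Y g. Hence a vector in the
    domain of pi Z for all Z in the Lie algebra has its whole orbit in these
    domains. *)
Lemma pi_op_conj (R : realType) (V : completeNormedModType R) (n : nat)
    (G : set 'M[R[i]]_n) (Pi : 'M[R[i]]_n -> {linear V -> V})
    (g Y : 'M[R[i]]_n) (x : V) :
  matrix_lie_group G -> is_representation G Pi -> G g -> lie_algebra G Y ->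
  dom (pi_op Pi (invmx g *m Y *m g)) x ->
  dom (pi_op Pi Y) (Pi g x) /\
  pi_op Pi Y (Pi g x) = Pi g (pi_op Pi (invmx g *m Y *m g) x).
Proof.
move=> GG [Pic Pi1 PiM] Gg GY dx; have [GU _ GM GV _] := GG.
have GY' : lie_algebra G (invmx g *m Y *m g).
  by have := lie_algebra_conj GG (GV _ Gg) GY; rewrite invmxK.
apply: pi_op_cvg.
have -> : (fun t : R => t^-1 *: (Pi (flow Y t) (Pi g x) - Pi g x)) =
    (fun t : R => Pi g (t^-1 *: (Pi (flow (invmx g *m Y *m g) t) x - x))).
  apply/funext => t; rewrite [RHS]linearZ [Pi g (_ - _)]linearB/=.
  congr (_ *: (_ - _)).
  rewrite -!PiM//; [|exact: lie_algebra_flow|exact: lie_algebra_flow].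
  have := flow_conj Y t (_ : invmx g \in unitmx).
  rewrite invmxK => ->; last by rewrite unitmx_inv; exact: GU.
  by rewrite !mulmxA mulmxV ?mul1mx//; exact: GU.
by apply: continuous_cvg; [exact: Pic|exact: pi_op_domP].
Qed.

Lemma rep_conj_cvg (R : realType) (V : completeNormedModType R) (n : nat)
    (G : set 'M[R[i]]_n) (Pi : 'M[R[i]]_n -> {linear V -> V})
    (X g : 'M[R[i]]_n) (M : R) (x : V) :
  matrix_lie_group G -> is_representation G Pi -> strongly_continuous G Pi ->
  (forall k, G k -> forall y, `|Pi k y| <= M * `|y|) ->
  lie_algebra G X -> G g ->
  Pi (flow X (- h) *m g *m flow X h) x @[h --> (0 : R)^'+] --> Pi g x.
Proof.
move=> GG PiG Pc PiM GX Gg; have [Pic _ PiMul] := PiG.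
have [_ _ GM _ _] := GG.
have -> : (fun h : R => Pi (flow X (- h) *m g *m flow X h) x) =
    (fun h : R => Pi (flow X (- h)) (Pi g (Pi (flow X h) x))).
  apply/funext => h; rewrite PiMul ?PiMul//; do ?[exact: lie_algebra_flow].
  by apply: GM => //; exact: lie_algebra_flow.
have cN y : Pi (flow X (- h)) y @[h --> (0 : R)^'+] --> y.
  apply: cvg_at_right_filter.
  have hN : (- h) @[h --> (0 : R)] --> - (0 : R) by apply: cvgN; exact: cvg_id.
  rewrite oppr0 in hN.
  exact: (cvg_comp _ _ hN (rep_flow_cvg (x := y) GG PiG Pc GX)).
apply: (cvg_bounded_family _ _ _ (cN (Pi g x))).
  by apply: nearW => h y; apply: PiM; exact: lie_algebra_flow.
apply: continuous_cvg; first exact: Pic.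
by apply: cvg_at_right_filter; exact: (rep_flow_cvg GG).
Qed.

(** Product rule for h |-> Pi (e^{hX}) Pi g Pi (e^{-hX}) u at h = 0. The outer
    factor converges only strongly, so the inner difference quotient is passed
    through it by the uniform bound. *)
Lemma rep_conj_left_derivative (R : realType) (V : completeNormedModType R)
    (n : nat) (G : set 'M[R[i]]_n) (Pi : 'M[R[i]]_n -> {linear V -> V})
    (X g : 'M[R[i]]_n) (M : R) (u : V) :
  matrix_lie_group G -> is_representation G Pi -> strongly_continuous G Pi ->
  (forall k, G k -> forall y, `|Pi k y| <= M * `|y|) ->
  lie_algebra G X -> G g ->
  dom (pi_op Pi X) u -> dom (pi_op Pi X) (Pi g u) ->
  h^-1 *: (Pi g u - Pi (flow X h *m g *m flow X (- h)) u) @[h --> (0 : R)^'+]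
    --> Pi g (pi_op Pi X u) - pi_op Pi X (Pi g u).
Proof.
move=> GG PiG Pc PiM GX Gg du dgu; have [Pic _ PiMul] := PiG.
have [_ _ GM _ _] := GG.
have -> : (fun h => h^-1 *: (Pi g u - Pi (flow X h *m g *m flow X (- h)) u)) =
    (fun h => Pi (flow X h)
                 (Pi g ((- h)^-1 *: (Pi (flow X (- h)) u - u))) -
              h^-1 *: (Pi (flow X h) (Pi g u) - Pi g u)).
  apply/funext => h.
  rewrite PiMul ?PiMul//; do ?[exact: lie_algebra_flow]; last first.
    by apply: GM => //; exact: lie_algebra_flow.
  rewrite invrN scaleNr -scalerN opprB !linearZ/= -[RHS]scalerDr.
  rewrite [Pi g (_ - _)]linearB [Pi (flow X h) (_ - _)]linearB/=.
  by congr (_ *: _); rewrite opprB [RHS]addrC addrA subrK.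
apply: cvgB; last by apply: cvg_dnbhs_at_right; exact: pi_op_domP.
apply: (@cvg_bounded_family _ _ _ _ _ (fun h => Pi (flow X h)) M _
  (Pi g (pi_op Pi X u))).
- by apply: nearW => h y; apply: PiM; exact: lie_algebra_flow.
- apply: continuous_cvg; first exact: Pic.
  have /cvg_dnbhs_at_left/cvg_at_leftNP := pi_op_domP du.
  by rewrite oppr0.
- by apply: cvg_at_right_filter; exact: (rep_flow_cvg GG).
Qed.

Lemma ae_exists_gt0 (R : realType) (P : R -> Prop) :
  {ae (@lebesgue_measure R), forall t : R, 0 < t -> P t} ->
  exists2 t, 0 < t & P t.
Proof.
move=> [B [mB B0 PB]]; apply: contrapT => noP.
have : (lebesgue_measure `]0%R, 1%R[%classic <= lebesgue_measure B :> \bar R)%E.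
  apply: le_measure; [by rewrite inE; exact: measurable_itv|by rewrite inE|].
  move=> t /=; rewrite in_itv/= => /andP[t0 _]; apply: PB => /= Pt.
  by apply: noP; exists t => //; exact: Pt.
by rewrite B0 lebesgue_measure_itv/= lte_fin ltr01 oppr0 adde0 lee_fin ler10.
Qed.

Lemma equivariant_comm (R : realType) (V : completeNormedModType R) (n : nat)
    (G : set 'M[R[i]]_n) (Pi : 'M[R[i]]_n -> {linear V -> V})
    (A : unbounded_op V) (F : V -> V) (g : 'M[R[i]]_n) (x : V) :
  matrix_lie_group G -> is_representation G Pi -> equivariant G Pi A F ->
  G g -> dom A x ->
  [/\ dom A (Pi g x), A (Pi g x) = Pi g (A x) & F (Pi g x) = Pi g (F x)].
Proof.
move=> [GU _ _ GV _] [_ Pi1 PiM] eqv Gg dx.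
have [dgx _ _] := eqv g x Gg dx; have [_ Ag Fg] := eqv g _ Gg dgx.
have PiVK : Pi (invmx g) (Pi g x) = x.
  by rewrite -PiM//; [rewrite mulVmx ?Pi1//; exact: GU|exact: GV].
by rewrite PiVK in Ag Fg.
Qed.

Lemma rep_inj (R : realType) (V : completeNormedModType R) (n : nat)
    (G : set 'M[R[i]]_n) (Pi : 'M[R[i]]_n -> {linear V -> V}) (g : 'M[R[i]]_n) :
  matrix_lie_group G -> is_representation G Pi -> G g -> injective (Pi g).
Proof.
move=> [GU _ _ GV _] [_ Pi1 PiM] Gg; apply: (can_inj (g := Pi (invmx g))) => x.
by rewrite -PiM//; [rewrite mulVmx ?Pi1//; exact: GU|exact: GV].
Qed.

(** The strong solution satisfies the equation at some time t > 0, where its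
    derivative is Pi (e^{tX}) (pi X u). Equivariance pulls the factor Pi (e^{tX})
    out of the whole equation and injectivity removes it. *)
Lemma stationary_equation (R : realType) (V : completeNormedModType R) (n : nat)
    (G : set 'M[R[i]]_n) (Pi : 'M[R[i]]_n -> {linear V -> V})
    (A : unbounded_op V) (F : V -> V) (X : 'M[R[i]]_n) (u : V) :
  matrix_lie_group G -> is_representation G Pi -> equivariant G Pi A F ->
  lie_algebra G X -> dom A u -> dom (pi_op Pi X) u ->
  strong_solution A F (fun t : R => Pi (expmx (t%:C *: X)) u) ->
  pi_op Pi X u = A u + F u.
Proof.
move=> GG PiG eqv GX dAu dXu [_ /ae_exists_gt0[t t0 [_ [drv drvE]]]].
have Gt := lie_algebra_flow t GX; have [Pic _ PiM] := PiG.
apply: (rep_inj GG PiG Gt); rewrite [RHS]linearD.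
have [_ <- <-] := equivariant_comm GG PiG eqv Gt dAu.
transitivity ('D_1 (fun t : R => Pi (expmx (t%:C *: X)) u) t); last first.
  by rewrite drvE flowE.
apply/esym; apply: cvg_lim; first exact: norm_hausdorff.
have -> : (fun h : R => h^-1 *: (((fun t : R => Pi (expmx (t%:C *: X)) u) \o
      shift t) (h *: 1) - Pi (expmx (t%:C *: X)) u)) =
    (fun h : R => Pi (flow X t) (h^-1 *: (Pi (flow X h) u - u))).
  apply/funext => h /=.
  rewrite [RHS]linearZ [Pi (flow X t) (_ - _)]linearB/= -PiM//; last first.
    exact: lie_algebra_flow.
  by rewrite !flowE -flowD [h%:A]mulr1 [t + h]addrC.
by apply: continuous_cvg; [exact: Pic|exact: pi_op_domP].
Qed.

(** * The comoving frame *)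

(** The curve v s = Pi (e^{-sX} k e^{sX}) u is the perturbed solution seen in the
    moving frame. It stays in the domain of the linearization, and combining
    its derivative Pi g (pi X u) - pi X (v s), with g = e^{-sX} k e^{sX}, with
    the stationary equation shows that w = v - u solves the linearized equation
    up to the defect F (u + w) - F u - F'(u) w. *)
Lemma comoving_estimate (R : realType) (V : completeNormedModType R) (n : nat)
    (G : set 'M[R[i]]_n) (Pi : 'M[R[i]]_n -> {linear V -> V})
    (A : unbounded_op V) (F : V -> V) (X k : 'M[R[i]]_n) (u : V)
    (S : R -> {linear V -> V}) (M eta d t : R) :
  matrix_lie_group G -> is_representation G Pi -> equivariant G Pi A F ->
  strongly_continuous G Pi ->
  (forall g, G g -> forall y, `|Pi g y| <= M * `|y|) ->
  lie_algebra G X -> dom A u ->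
  (forall Z, lie_algebra G Z -> dom (pi_op Pi Z) u) ->
  pi_op Pi X u = A u + F u ->
  C0_semigroup S -> (forall s, 0 <= s -> forall y, `|S s y| <= M * `|y|) ->
  generates (linearized_op Pi A F X u) S ->
  0 <= M -> 0 <= eta -> 0 <= t -> M * eta * t <= 2^-1 ->
  (forall w, `|w| <= d -> `|F (u + w) - F u - 'd F u w| <= eta * `|w|) ->
  G k ->
  (forall s, 0 <= s <= t ->
     `|Pi (flow X (- s) *m k *m flow X s) u - u| <= d) ->
  `|Pi (flow X (- t) *m k *m flow X t) u - u - S t (Pi k u - u)| <=
  2 * M ^+ 2 * t * `|Pi k u - u| * eta.
Proof.
move=> GG PiG eqv Pc PiM GX dAu upi stat SS SM [domS genE] M0 eta0 t0 small
  frechet Gk near_u.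
have [GU G1 GM GV _] := GG.
pose g s := flow X (- s) *m k *m flow X s.
have Gg s : G (g s).
  by apply: (GM); [apply: (GM) => //|]; exact: lie_algebra_flow.
have gD s h : g (s + h) = flow X (- h) *m g s *m flow X h.
  by rewrite /g opprD [- s - h]addrC !flowD !mulmxA.
have dgu s : dom (pi_op Pi X) (Pi (g s) u).
  apply: (pi_op_conj GG PiG (Gg s) GX _).1; apply: upi.
  have := lie_algebra_conj GG (GV _ (Gg s)) GX.
  by rewrite invmxK.
have dgen x : dom A x -> dom (pi_op Pi X) x -> dom (generator S) x.
  by move=> dA dX; rewrite domS; split.
have dgenu := dgen _ dAu (upi _ GX).
have eqvg s := equivariant_comm GG PiG eqv (Gg s) dAu.
have dgeng s : dom (generator S) (Pi (g s) u).
  by apply: dgen => //; case: (eqvg s).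
have genv x : dom (generator S) x ->
    generator S x = A x - pi_op Pi X x + 'd F u x by exact: genE.
pose w s := Pi (g s) u - u.
pose dw s := Pi (g s) (pi_op Pi X u) - pi_op Pi X (Pi (g s) u).
have w0 : w 0 = Pi k u - u by rewrite /w /g oppr0 flow0 mul1mx mulmx1.
rewrite -w0.
apply: (perturbation_estimate (B := d) (dw := dw)) => //.
- move=> s _; apply: cvgB; last exact: cvg_cst.
  have -> : (fun h => Pi (g (s + h)) u) =
      (fun h => Pi (flow X (- h) *m g s *m flow X h) u).
    by apply/funext => h; rewrite gD.
  exact: (rep_conj_cvg GG PiG Pc PiM GX (Gg s)).
- by move=> s _; exact: (generatorB (dgeng s) dgenu).1.
- move=> s _.
  have -> : (fun h => h^-1 *: (w s - w (s - h))) =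
      (fun h => h^-1 *: (Pi (g s) u - Pi (flow X h *m g s *m flow X (- h)) u)).
    by apply/funext => h; rewrite /w gD opprK opprB addrA subrK.
  exact: (rep_conj_left_derivative GG PiG Pc PiM GX (Gg s) (upi _ GX) (dgu s)).
move=> s /andP[s0 st].
have [_ As Fs] := eqvg s.
have -> : dw s - generator S (w s) = F (u + w s) - F u - 'd F u (w s).
  rewrite (generatorB (dgeng s) dgenu).2 genv// genv// /dw stat linearD -As -Fs.
  rewrite /w [in RHS]linearB [u + _]addrC subrK.
  set a := A (Pi _ _); set f := F (Pi _ _); set p := pi_op _ _ _.
  have -> : A u - (A u + F u) = - F u by rewrite opprD addrA subrr add0r.
  set l := 'd F u (Pi _ _); set l0 := 'd F u u.
  have -> : a + f - p = f + (a - p) by rewrite addrAC addrC.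
  have -> : a - p + l - (- F u + l0) = a - p + (l - l0 + F u).
    by rewrite opprD opprK [F u - l0]addrC -!addrA.
  by rewrite addrKA opprD [- _ - F u]addrC addrA.
by apply: frechet; apply: near_u; rewrite ltW.
Qed.

Theorem proposition3p9 (R : realType) (V : completeNormedModType R)
    (A : unbounded_op V) (F : V -> V)
    (n : nat) (G : set 'M[R[i]]_n) (N : 'M[R[i]]_n -> R)
    (Pi : 'M[R[i]]_n -> {linear V -> V})
    (X : 'M[R[i]]_n) (ustar : V) (S : R -> {linear V -> V})
    (A_closed : closed_linear_op A)
    (G_lie : matrix_lie_group G)
    (N_norm : norm_on (lie_algebra G) N)
    (Pi_rep : is_representation G Pi)
    (Pi_equiv : equivariant G Pi A F)
    (Pi_cont : strongly_continuous G Pi)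
    (Pi_bounded : uniformly_bounded G Pi)
    (X_lie : lie_algebra G X)
    (ustar_dom : (dom A `&` dom (pi_op Pi X)) ustar)
    (ustar_sol : strong_solution A F (fun t : R => Pi (expmx (t%:C *: X)) ustar))
    (ustar_pi : forall Y, lie_algebra G Y -> dom (pi_op Pi Y) ustar)
    (ustar_quad : exists C : R, forall Y, lie_algebra G Y ->
       `|Pi (expmx Y) ustar - ustar - pi_op Pi Y ustar| <= C * N Y ^+ 2)
    (F_diff : differentiable F ustar)
    (S_semigroup : C0_semigroup S)
    (S_bounded : uniformly_bounded [set t : R | 0 <= t] S)
    (S_generated : generates (linearized_op Pi A F X ustar) S) :
  let L := fun Y => lie_bracket Y X in
  forall (t : R) (Y : 'M[R[i]]_n), 0 <= t -> lie_algebra G Y ->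
    [/\ lie_algebra G (exp_lin t L Y),
        lie_algebra G (expmx (- t%:C *: X) *m Y *m expmx (t%:C *: X)),
        S t (pi_op Pi Y ustar) = pi_op Pi (exp_lin t L Y) ustar &
        pi_op Pi (exp_lin t L Y) ustar =
          pi_op Pi (expmx (- t%:C *: X) *m Y *m expmx (t%:C *: X)) ustar].

Proof.
move=> L t Y t0 GY; rewrite {}/L exp_linE.
have -> : expmx (- t%:C *: X) = flow X (- t) by rewrite -flowE rmorphN.
rewrite flowE; set Z := flow X (- t) *m Y *m flow X t.
have GZ : lie_algebra G Z.
  have := lie_algebra_conj G_lie (lie_algebra_flow (- t) X_lie) GY.
  by rewrite invmx_flow opprK.
split => //.
have [dAu dXu] := ustar_dom.
have stat := stationary_equation G_lie Pi_rep Pi_equiv X_lie dAu dXu ustar_sol.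
have [MP PiMP] := Pi_bounded; have [MS SMS] := S_bounded.
pose M := Num.max 0 (Num.max MP MS).
have M0 : 0 <= M by rewrite le_max lexx.
have PiM g : G g -> forall y, `|Pi g y| <= M * `|y|.
  move=> Gg y; apply: le_trans (PiMP g Gg y) _; apply: ler_wpM2r => //.
  by rewrite !le_max lexx orbT.
have SM s : 0 <= s -> forall y, `|S s y| <= M * `|y|.
  move=> s0 y; apply: le_trans (SMS s s0 y) _; apply: ler_wpM2r => //.
  by rewrite !le_max lexx !orbT.
pose q := pi_op Pi Y ustar; pose p := pi_op Pi Z ustar.
suff pq : p = S t q by symmetry; exact: pq.
pose C := 2 * M ^+ 2 * t.
have C0 : 0 <= C by rewrite /C !mulr_ge0// exprn_ge0.
have flowZ e : flow Z e = flow X (- t) *m flow Y e *m flow X t.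
  have := flow_conj Y e (flow_unit X (- t)).
  by rewrite invmx_flow opprK.
(* Dividing the comoving estimate by e and letting e tend to 0 leaves a bound
   proportional to eta, which is arbitrary. *)
have key eta : 0 < eta -> M * eta * t <= 2^-1 ->
    `|p - S t q| <= C * `|q| * eta.
  move=> eta0 small.
  have [d d0 frechet] := differentiable_remainder F_diff eta0.
  have [r r0 near1] := rep_continuous_at1 ustar G_lie Pi_rep Pi_cont d0.
  (* The perturbation k = e^{eY} gives conjugates close to 1 uniformly on [0, t],
     so the remainder bound applies along the whole curve for small e > 0. *)
  have near_est : \forall e \near (0 : R)^'+,
      `|e^-1 *: (Pi (flow Z e) ustar - ustar) -
        S t (e^-1 *: (Pi (flow Y e) ustar - ustar))| <=
      C * `|e^-1 *: (Pi (flow Y e) ustar - ustar)| * eta.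
    have conj1 : \forall e \near (0 : R)^'+, forall s, 0 <= s <= t ->
        mxl1 (flow X (- s) *m flow Y e *m flow X s - 1%:M) < r.
      exact: (cvg_at_right_filter cvg_id (flow_conj_near1 X Y t r0)).
    near=> e.
    have e0 : 0 < e by near: e; exact: nbhs_right_gt.
    have er : forall s, 0 <= s <= t ->
        mxl1 (flow X (- s) *m flow Y e *m flow X s - 1%:M) < r.
      by near: e; exact: conj1.
    have Gs s : G (flow X (- s) *m flow Y e *m flow X s).
      have [_ _ GM _ _] := G_lie.
      by apply: (GM); [apply: (GM)|]; exact: lie_algebra_flow.
    have est := comoving_estimate G_lie Pi_rep Pi_equiv Pi_cont PiM X_lie dAu
      ustar_pi stat S_semigroup SM S_generated M0 (ltW eta0) t0 small frechet
      (lie_algebra_flow e GY) (fun s st => ltW (near1 _ (Gs s) (er s st))).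
    rewrite linearZ -scalerBr !normrZ flowZ [C * (_ * _)]mulrCA -[leRHS]mulrA.
    by apply: ler_wpM2l.
  have St_cont : continuous (S t) by case: S_semigroup => + _ _ _; apply.
  have cq := cvg_dnbhs_at_right (pi_op_domP (ustar_pi _ GY)).
  have cp := cvg_dnbhs_at_right (pi_op_domP (ustar_pi _ GZ)).
  have lim_est : (C * `|e^-1 *: (Pi (flow Y e) ustar - ustar)| * eta -
      `|e^-1 *: (Pi (flow Z e) ustar - ustar) -
        S t (e^-1 *: (Pi (flow Y e) ustar - ustar))|) @[e --> 0^'+] -->
      C * `|q| * eta - `|p - S t q|.
    apply: cvgB.
      by apply: cvgMr_tmp; apply: cvgMl_tmp; exact: (cvg_norm cq).
    apply: cvg_norm; apply: cvgB; first exact: cp.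
    by apply: continuous_cvg; [exact: St_cont|exact: cq].
  rewrite -subr_ge0; apply: (cvgr_to_ge lim_est).
  by apply: filterS near_est => e; rewrite subr_ge0.
apply/eqP; rewrite -subr_eq0 -normr_le0; apply/ler_addgt0Pr => e e0.
rewrite add0r.
have Cq : 0 < C * `|q| + 1 by rewrite ltr_wpDl// mulr_ge0.
have Mt : 0 < M * t + 1 by rewrite ltr_wpDl// mulr_ge0.
pose eta := Num.min (e / (C * `|q| + 1)) (2^-1 / (M * t + 1)).
have eta0 : 0 < eta by rewrite lt_min !divr_gt0.
apply: le_trans (key eta eta0 _) _.
  have : eta <= 2^-1 / (M * t + 1) by rewrite ge_min lexx orbT.
  rewrite ler_pdivlMr// => h; apply: le_trans h.
  by rewrite mulrAC [leRHS]mulrC; apply: ler_wpM2r; [exact: ltW|rewrite lerDl].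
have : eta <= e / (C * `|q| + 1) by rewrite ge_min lexx.
rewrite ler_pdivlMr// => h; apply: le_trans h.
by rewrite [leRHS]mulrC; apply: ler_wpM2r; [exact: ltW|rewrite lerDl].
Unshelve. all: by end_near. Qed.
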